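(* Let $G = (X, Y; E)$ be a connected balanced bipartite graph of order $2n$ with $n \geq 4$, with $e$ edges and minimum degree $\delta \geq 2$. If $\lambda_1 \geq \sqrt{n^2 - 2n + 4}$, where $\lambda_1$ is the largest eigenvalue of the adjacency matrix of $G$, then $G$ is bipancyclic.
   Context: Graphs are finite, undirected, without loops or multiple edges. A bipartite graph $G=(X,Y;E)$ with parts $X$ and $Y$ is balanced if $|X|=|Y|$. A bipartite graph $G$ is bipancyclic if it contains cycles of every even length from $4$ to $|V(G)|$. *)

(* Defs.v *)
From HB Require Import structures.
From mathcomp Require Export all_boot all_order all_algebra.
From mathcomp Require Export reals.

Set Implicit Arguments.
Unset Strict Implicit.
Unset Printing Implicit Defensive.

Import Order.TTheory GRing.Theory Num.Theory.

(* A finite simple graph is a finite vertex type V with an adjacency relation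
   E : rel V that is symmetric and irreflexive. *)

Section Graph.

Variables (V : finType) (E : rel V).

Definition simple_graph : Prop := symmetric E /\ irreflexive E.

Definition edges : {set {set V}} :=
  [set [set p.1; p.2] | p in [pred p : V * V | E p.1 p.2]].

Definition degree (v : V) : nat := #|[set w | E v w]|.

(* Every degree is less than #|V|, so the default value is never reached when V
   is nonempty. *)
Definition min_degree : nat := \big[minn/#|V|]_(v : V) degree v.

Definition connected_graph : Prop := forall u v : V, connect E u v.

Definition bipartition (X Y : {set V}) : Prop :=
  [/\ X :|: Y = [set: V],
      [disjoint X & Y] &
      forall u v : V, E u v ->
        (u \in X /\ v \in Y) \/ (u \in Y /\ v \in X)].

(* [cycle] also accepts sequences of size at most 2, hence the bound on k. *)
Definition has_cycle_of_length (k : nat) : Prop :=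
  2 < k /\ exists2 c : seq V, size c = k & ucycle E c.

Definition bipancyclic : Prop :=
  forall k : nat, 4 <= k <= #|V| -> ~~ odd k -> has_cycle_of_length k.

Definition adjacency_matrix (R : realType) : 'M[R]_#|V| :=
  (\matrix_(i, j) (E (enum_val i) (enum_val j))%:R)%R.

End Graph.

Definition largest_eigenvalue (R : realType) (m : nat) (A : 'M[R]_m) (l : R)
    : Prop :=
  eigenvalue A l /\ forall a : R, eigenvalue A a -> (a <= l)%R.

(* Main.v *)
Require Import Defs.
From mathcomp Require Import all_boot all_order all_algebra.
From mathcomp Require Import reals.
From mathcomp Require Import zify ring lra.

(* Let f be an eigenfunction for l, S the sum of f^2 over one part (both parts
   give the same sum) and e the number of edges. Then
     sum over X * Y of (S * E x y - l * f x * f y)^2 = S^2 * (e - l^2),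
   so l^2 < e unless the 0/1 biadjacency matrix has rank one, in which case it
   is all ones. Hence fewer than 2n - 4 edges of K_{n,n} are missing, and with
   minimum degree 2 the Moon-Moser theorem gives a Hamiltonian cycle. Deleting
   on each side a vertex with most missing edges preserves these conditions for
   n - 1, unless it leaves K_{n-1,n-1}, which contains all shorter even
   cycles. *)

Set Implicit Arguments.
Unset Strict Implicit.
Unset Printing Implicit Defensive.

Import Order.TTheory GRing.Theory Num.Theory.

Section EdgeCounting.

Variable V : finType.
Implicit Types (E : rel V) (A B : {set V}).

Definition neighbors E B v : {set V} := [set w in B | E v w].

Definition degree_in E B v : nat := #|neighbors E B v|.

Definition edges_between E A B : nat := \sum_(a in A) degree_in E B a.

Definition compl_rel E : rel V := fun u v => ~~ E u v.

Lemma compl_rel_sym E : symmetric E -> symmetric (compl_rel E).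
Proof. by move=> symE u v; rewrite /compl_rel symE. Qed.

Definition non_edges E A B : nat := edges_between (compl_rel E) A B.

Lemma degree_in_sum E B v : degree_in E B v = \sum_(w in B) E v w.
Proof.
rewrite /degree_in -sum1_card big_mkcond [RHS]big_mkcond.
by apply: eq_bigr => w _; rewrite inE; case: (w \in B); case: (E v w).
Qed.

Lemma neighbors_subset E B v : neighbors E B v \subset B.
Proof. by rewrite /neighbors setIdE subsetIl. Qed.

Lemma sub_degree_in E E' B v :
  subrel E E' -> degree_in E B v <= degree_in E' B v.
Proof.
move=> subE; apply/subset_leq_card/subsetP=> w; rewrite !inE.
by case/andP=> -> /subE.
Qed.

Lemma degree_in_compl E B v :
  degree_in E B v + degree_in (compl_rel E) B v = #|B|.
Proof.
rewrite !degree_in_sum -big_split -sum1_card /=.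
by apply: eq_bigr => w _; rewrite /compl_rel; case: (E v w).
Qed.

Lemma degree_inD1 E B v w :
  w \in B -> degree_in E B v = E v w + degree_in E (B :\ w) v.
Proof. by move=> wB; rewrite !degree_in_sum (big_setD1 w). Qed.

Lemma edges_betweenC E A B :
  symmetric E -> edges_between E A B = edges_between E B A.
Proof.
move=> symE; rewrite /edges_between.
under eq_bigr do rewrite degree_in_sum.
under [RHS]eq_bigr do rewrite degree_in_sum.
rewrite exchange_big; apply: eq_bigr => b _.
by apply: eq_bigr => a _; rewrite symE.
Qed.

Lemma edges_between_compl E A B :
  edges_between E A B + non_edges E A B = #|A| * #|B|.
Proof.
rewrite /non_edges /edges_between -big_split -sum_nat_const /=.
by apply: eq_bigr => a _; apply: degree_in_compl.
Qed.

Lemma edges_between_gt0P E A B :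
  reflect (exists x y, [/\ x \in A, y \in B & E x y]) (0 < edges_between E A B).
Proof.
rewrite lt0n sum_nat_eq0 negb_forall.
apply: (iffP existsP) => [[x] | [x [y [xA yB Exy]]]].
  rewrite negb_imply cards_eq0 => /andP[xA /set0Pn[y]].
  by rewrite inE => /andP[yB Exy]; exists x, y.
exists x; rewrite negb_imply xA cards_eq0 /=.
by apply/set0Pn; exists y; rewrite inE yB.
Qed.

Lemma non_edges_eq0P E A B :
  reflect {in A & B, forall x y, E x y} (non_edges E A B == 0).
Proof.
rewrite eqn0Ngt; apply: (iffP idP) => [noE x y xA yB | allE].
  by apply: contraNT noE => nE; apply/edges_between_gt0P; exists x, y.
by apply/negP=> /edges_between_gt0P[x [y [xA yB]]]; rewrite /compl_rel allE.
Qed.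

Lemma ltn_edges_between E E' A B x y :
    subrel E E' -> x \in A -> y \in B -> ~~ E x y -> E' x y ->
  edges_between E A B < edges_between E' A B.
Proof.
move=> subE xA yB nExy E'xy.
rewrite /edges_between (big_setD1 x xA) [ltnRHS](big_setD1 x xA) -addSn /=.
apply: leq_add; last by apply: leq_sum => a _; apply: sub_degree_in.
rewrite (degree_inD1 _ _ yB) [ltnRHS](degree_inD1 _ _ yB) E'xy (negPf nExy).
by rewrite ltnS sub_degree_in.
Qed.

Lemma edges_betweenD1 E A B x y :
    symmetric E -> x \in A -> y \in B ->
  edges_between E A B + E x y =
  edges_between E (A :\ x) (B :\ y) + degree_in E B x + degree_in E A y.
Proof.
move=> symE xA yB; rewrite /edges_between (big_setD1 x xA) /=.
under eq_bigr do rewrite (degree_inD1 _ _ yB) symE.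
rewrite big_split /= -degree_in_sum (degree_inD1 _ y xA) symE; lia.
Qed.

Lemma low_degree_non_edges E A B (S : {set V}) k :
    S \subset A -> {in S, forall a, degree_in E B a <= k} ->
  #|S| * (#|B| - k) <= non_edges E A B.
Proof.
move=> subSA degS; rewrite -sum_nat_const /non_edges /edges_between.
rewrite [leqRHS](big_setID S) /= (setIidPr subSA).
apply: leq_trans (leq_addr _ _); apply: leq_sum => a /degS.
have := degree_in_compl E B a; lia.
Qed.

Lemma delete_max_degree_pair E A B :
    symmetric E -> A != set0 -> B != set0 ->
  exists x y, [/\ x \in A, y \in B,
    {in A, forall a, degree_in E B a <= degree_in E B x},
    {in B, forall b, degree_in E A b <= degree_in E A y} &
    edges_between E (A :\ x) (B :\ y) = 0 \/
    edges_between E (A :\ x) (B :\ y) + 2 <= edges_between E A B].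
Proof.
move=> symE /set0Pn[x0 x0A] /set0Pn[y0 y0B].
case: (@arg_maxnP _ x0 (mem A) (degree_in E B) x0A) => x xA maxx.
case: (@arg_maxnP _ y0 (mem B) (degree_in E A) y0B) => y yB maxy.
have [rest0 | /edges_between_gt0P[a [b []]]] :=
  posnP (edges_between E (A :\ x) (B :\ y)); first by exists x, y; split; auto.
rewrite !inE => /andP[_ aA] /andP[b_y bB] Eab.
have degb_gt0 : 0 < degree_in E A b by rewrite (degree_inD1 _ _ aA) symE Eab.
have degx_gt0 : 0 < degree_in E B x.
  by apply: leq_trans (maxx a aA); rewrite (degree_inD1 _ _ bB) Eab.
have degy_max := maxy b bB.
have count_xy := edges_betweenD1 symE xA yB.
have [Exy | nExy] := boolP (E x y); last first.
  exists x, y; split=> //; right; rewrite (negPf nExy) in count_xy; lia.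
rewrite Exy in count_xy.
have [deg_big | deg_small] := leqP 3 (degree_in E B x + degree_in E A y).
  by exists x, y; split=> //; right; lia.
(* Now y is the only neighbour of x, so (x, b) is a non-adjacent pair whose
   vertices also have the maximal degree 1. *)
have nExb : E x b = false.
  have : degree_in E B x = 1 by lia.
  rewrite (degree_inD1 _ _ yB) Exy (@degree_inD1 _ _ _ b) ?inE ?b_y //.
  by case: (E x b).
exists x, b; split=> // [b' /maxy | ]; first lia.
by have := edges_betweenD1 symE xA bB; rewrite nExb; lia.
Qed.

End EdgeCounting.

Lemma sym_rev_path (T : Type) (e : rel T) x p :
  symmetric e -> path e (last x p) (rev (belast x p)) = path e x p.
Proof. by move=> syme; rewrite rev_path; apply: eq_path => u v. Qed.

Lemma perm_cons_cat_cons (T : eqType) (a b : T) c s t :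
  perm_eq c (s ++ t) -> perm_eq [:: a, b & c] ((a :: s) ++ b :: t).
Proof.
move=> eq_c; rewrite perm_cons perm_sym (perm_catCA s [:: b]) perm_cons.
by rewrite perm_sym.
Qed.

(* Rotation of a Hamiltonian path: follow p, jump to its other end, and run
   the rest backwards to w, which is adjacent to x. *)
Lemma crossover_cycle (T : Type) (e : rel T) x p w q :
    symmetric e -> path e x (p ++ w :: q) ->
    e x w -> e (last w q) (last x p) ->
  cycle e (x :: p ++ rev (w :: q)).
Proof.
move=> syme; rewrite cat_path => /and3P[pathp _ pathq] exw elast.
rewrite /= rcons_cat cat_path pathp /= -rev_cons lastI rev_rcons /= syme elast.
by rewrite (sym_rev_path x (w :: q) syme) /= exw.
Qed.

Lemma prev_cat_cons (T : eqType) (x : T) p w q :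
  w \notin p -> prev (x :: p ++ w :: q) w = last x p.
Proof.
rewrite /=; elim: p {2 3}x => [|z p IHp] y /=; first by rewrite eqxx.
by rewrite inE negb_or => /andP[/negPf-> /IHp].
Qed.

Section Hamiltonicity.

Variable V : finType.
Implicit Types (E : rel V) (A B : {set V}).

Definition independent E A : Prop := {in A &, forall u v, ~~ E u v}.

Definition bipartite_on E A B : Prop :=
  [/\ [disjoint A & B], independent E A & independent E B].

Definition hamiltonian_on E A : Prop := exists2 c, ucycle E c & c =i A.

Definition add_edge E x y : rel V :=
  fun u v => [|| E u v, (u == x) && (v == y) | (u == y) && (v == x)].

Lemma bipartite_on_subset E A B A' B' :
    A' \subset A -> B' \subset B ->
  bipartite_on E A B -> bipartite_on E A' B'.
Proof.
move=> /[dup] sA /subsetP-sA' /[dup] sB /subsetP-sB' [dAB indA indB]; split.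
- exact: disjointWl sA (disjointWr sB dAB).
- by move=> u v /sA' uA /sA'; apply: indA.
- by move=> u v /sB' uB /sB'; apply: indB.
Qed.

Lemma bipartite_on_card E A B :
  bipartite_on E A B -> #|A :|: B| = #|A| + #|B|.
Proof. by case=> dAB _ _; apply/eqP; rewrite leq_card_setU. Qed.

Lemma hamiltonian_on_cycle E A :
  2 < #|A| -> hamiltonian_on E A -> has_cycle_of_length E #|A|.
Proof.
move=> gt2 [c Uc cA]; split=> //; exists c => //.
by case/andP: Uc => _ /card_uniqP <-; apply: eq_card.
Qed.

Lemma add_edge_sub E x y : subrel E (add_edge E x y).
Proof. by move=> u v Euv; rewrite /add_edge Euv. Qed.

Lemma add_edge_sym E x y : symmetric E -> symmetric (add_edge E x y).
Proof.
move=> symE u v; rewrite /add_edge symE; congr (_ || _).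
by rewrite orbC ![(v == _) && _]andbC.
Qed.

Lemma add_edge_bipartite_on E A B x y :
    x \in A -> y \in B ->
  bipartite_on E A B -> bipartite_on (add_edge E x y) A B.
Proof.
move=> xA yB [dAB indA indB].
have [xB yA] : x \notin B /\ y \notin A.
  by rewrite (disjointFr dAB xA) (disjointFl dAB yB).
split=> // u v uS vS; rewrite /add_edge.
  rewrite (negPf (indA u v uS vS)) (negPf (memPn yA u uS)).
  by rewrite (negPf (memPn yA v vS)) andbF.
rewrite (negPf (indB u v uS vS)) (negPf (memPn xB u uS)).
by rewrite (negPf (memPn xB v vS)) andbF.
Qed.

Lemma add_edge_avoid E x y : {in predC1 x &, add_edge E x y =2 E}.
Proof.
move=> u v; rewrite !inE /add_edge => /negPf-> /negPf->.
by rewrite andbF !orbF.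
Qed.

Lemma add_edge_ucycle E x y c :
    symmetric E -> 2 < size c -> ucycle (add_edge E x y) c ->
  ucycle E c \/
  exists s, [/\ perm_eq (x :: s) c, path E x s & last x s = y].
Proof.
move=> symE szc /andP[cycc Uc].
have [/rot_to[i s def_c] | xc] := boolP (x \in c); last first.
  left; rewrite /ucycle Uc andbT -(eq_in_cycle (@add_edge_avoid E x y)) //.
  by apply/allP=> v vc; apply: contraNneq xc => <-.
have eq_c : perm_eq (x :: s) c by rewrite -def_c perm_rot.
rewrite -(perm_uniq eq_c) in Uc; rewrite -(perm_size eq_c) in szc.
case: s => [|z s] // in def_c eq_c szc Uc *.
have xs : x \notin z :: s by case/andP: Uc.
have [z_x last_x] : z != x /\ last z s != x.
  by split; apply: contraNneq xs => <-; rewrite ?mem_head ?mem_last.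
have z_last : z != last z s.
  case: s {def_c eq_c xs last_x} szc Uc => //= t s _ /and3P[_ zs _].
  by apply: contraNneq zs => ->; apply: mem_last.
move: cycc; rewrite -(rot_cycle i) def_c /= rcons_path /= /add_edge eqxx.
rewrite (negPf z_x) (negPf last_x) andbF andbT /= !orbF.
case/and3P=> Exz pathE Elast.
have {}pathE : path E z s.
  rewrite -(eq_in_path (@add_edge_avoid E x y)) //.
  by apply/allP=> v vs; apply: contraNneq xs => <-.
have [last_y | last_y] := eqVneq (last z s) y.
  rewrite -last_y (negPf z_last) orbF in Exz.
  by right; exists (z :: s); split=> //=; rewrite Exz.
rewrite (negPf last_y) orbF in Elast.
case/orP: Exz => [Exz | /eqP z_y].
  left; rewrite -(rot_ucycle i) /ucycle def_c Uc /=.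
  by rewrite Exz rcons_path pathE Elast.
right; exists (rev (z :: s)); split.
- by apply: perm_trans eq_c; rewrite perm_cons perm_rev.
- by rewrite lastI rev_rcons /= symE Elast sym_rev_path.
- by rewrite rev_cons last_rcons.
Qed.

Lemma exists_crossover E A B x s :
    independent E B -> uniq (x :: s) -> x :: s =i A :|: B ->
    path E x s -> x \notin B ->
    #|A| < degree_in E B x + degree_in E A (last x s) ->
  exists p w q, [/\ s = p ++ w :: q, E x w & E (last w q) (last x p)].
Proof.
move=> indB Us sAB paths xB ltA; pose N := neighbors E B x.
have splitN w : w \in N ->
    exists p q, s = p ++ w :: q /\ prev (x :: s) w = last x p.
  rewrite inE => /andP[wB _].
  have : w \in x :: s by rewrite sAB inE wB orbT.
  rewrite inE => /predU1P[w_x | ws]; first by rewrite -w_x wB in xB.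
  case/splitPr: ws Us => p q Us; exists p, q; split=> //.
  move: Us; rewrite cons_uniq -cat_rcons cat_uniq rcons_uniq.
  by case/and3P=> _ /andP[wp _] _; rewrite cat_rcons prev_cat_cons.
have predA : [set prev (x :: s) w | w in N] \subset A.
  apply/subsetP=> _ /imsetP[w wN ->]; have [p [q [def_s ->]]] := splitN w wN.
  have : last x p \in A :|: B by rewrite -sAB def_s -cat_cons mem_cat mem_last.
  rewrite inE => /orP[// | pB]; move: paths wN.
  rewrite def_s cat_path inE => /and3P[_ Epw _] /andP[wB _].
  by have := indB _ _ pB wB; rewrite Epw.
have /set0Pn[u] :
    [set prev (x :: s) w | w in N] :&: neighbors E A (last x s) != set0.
  apply: contraTneq ltA => disj; rewrite -leqNgt /degree_in -/N.
  rewrite -(card_imset _ (can_inj (next_prev Us))) -cardsUI disj cards0 addn0.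
  by apply: subset_leq_card; rewrite subUset predA neighbors_subset.
rewrite !inE => /andP[/imsetP[w wN ->] /andP[_]].
have [p [q [def_s ->]]] := splitN w wN; rewrite {1}def_s last_cat /= => Ey.
by exists p, w, q; move: wN; rewrite inE => /andP[].
Qed.

Lemma hamiltonian_on_add_edge E A B x y :
    symmetric E -> bipartite_on E A B -> 2 < #|A :|: B| -> x \in A ->
    #|A| < degree_in E B x + degree_in E A y ->
  hamiltonian_on (add_edge E x y) (A :|: B) -> hamiltonian_on E (A :|: B).
Proof.
move=> symE [dAB _ indB] gt2 xA deg_sum [c Uc cAB].
have szc : 2 < size c.
  by case/andP: Uc => _ /card_uniqP <-; rewrite (eq_card cAB).
have [|[s [eq_c paths last_s]]] := add_edge_ucycle symE szc Uc.
  by exists c.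
have Us : uniq (x :: s) by rewrite (perm_uniq eq_c); case/andP: Uc.
have sAB : x :: s =i A :|: B by move=> v; rewrite (perm_mem eq_c) cAB.
rewrite -last_s in deg_sum.
have xB : x \notin B by rewrite (disjointFr dAB).
have [p [w [q [def_s Exw Elast]]]] :=
  exists_crossover indB Us sAB paths xB deg_sum.
have eq_s : perm_eq (x :: p ++ rev (w :: q)) (x :: s).
  by rewrite def_s perm_cons perm_cat2l perm_rev.
exists (x :: p ++ rev (w :: q)); last by move=> v; rewrite (perm_mem eq_s) sAB.
rewrite /ucycle (perm_uniq eq_s) Us andbT.
by apply: crossover_cycle; rewrite -?def_s.
Qed.

Lemma complete_bipartite_path E (s t : seq V) b :
    symmetric E -> size s = size t -> {in s & b :: t, forall u v, E u v} ->
  exists c, [/\ perm_eq c (s ++ t), path E b c & last b c \in b :: t].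
Proof.
move=> symE; elim: s t b => [|a s IHs] [|b' t] b //=.
  by exists [::]; rewrite mem_head.
case=> szst Est.
have [u v us vt | c [eq_c pathc lastc]] := IHs t b' szst.
  by apply: Est; rewrite inE ?us ?vt orbT.
exists [:: a, b' & c]; split.
- exact: perm_cons_cat_cons.
- by rewrite /= pathc symE !Est ?inE ?eqxx ?orbT.
- by rewrite inE lastc orbT.
Qed.

Lemma complete_bipartite_hamiltonian E A B :
    symmetric E -> [disjoint A & B] -> #|A| = #|B| ->
    {in A & B, forall x y, E x y} ->
  hamiltonian_on E (A :|: B).
Proof.
move=> symE dAB eqAB complete.
suff [c eq_c cycc] : exists2 c, perm_eq c (enum A ++ enum B) & cycle E c.
  exists c; last by move=> v; rewrite (perm_mem eq_c) mem_cat !mem_enum inE.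
  rewrite /ucycle cycc (perm_uniq eq_c) cat_uniq !enum_uniq andbT /=.
  by apply/hasPn=> v; rewrite /= !mem_enum => /(disjointFl dAB)->.
have: {in enum A & enum B, forall u v, E u v}.
  by move=> u v; rewrite !mem_enum; apply: complete.
have: size (enum A) = size (enum B) by rewrite -!cardE.
case: (enum A) (enum B) => [|a s] [|b t] //=; first by exists [::].
case=> szst Est.
have [u v us vt|c [eq_c pathc lastc]] :=
    @complete_bipartite_path E s t b symE szst.
  by apply: Est => //; rewrite inE us orbT.
exists [:: a, b & c].
  exact: perm_cons_cat_cons.
by rewrite /= rcons_path pathc [E _ a]symE !Est ?mem_head.
Qed.

Lemma complete_bipartite_cycles E A B k :
    symmetric E -> bipartite_on E A B -> 1 < k <= #|A| -> k <= #|B| ->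
    {in A & B, forall x y, E x y} ->
  has_cycle_of_length E (2 * k).
Proof.
move=> symE bipE /andP[gt1 kA] kB complete.
have subset_of_card (C : {set V}) :
    k <= #|C| -> exists2 D : {set V}, D \subset C & #|D| = k.
  rewrite -bin_gt0 -cards_draws => /card_gt0P[D].
  by rewrite inE => /andP[subDC /eqP]; exists D.
have [A' sA cardA] := subset_of_card A kA.
have [B' sB cardB] := subset_of_card B kB.
have bipE' := bipartite_on_subset sA sB bipE.
have cardAB : #|A' :|: B'| = 2 * k.
  by rewrite (bipartite_on_card bipE') cardA cardB mul2n addnn.
rewrite -cardAB; apply: hamiltonian_on_cycle; first by rewrite cardAB; lia.
apply: complete_bipartite_hamiltonian => //; first by case: bipE'.
  by rewrite cardA.
by move=> a b /(subsetP sA) aA /(subsetP sB); apply: complete.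
Qed.

End Hamiltonicity.

Section FewNonEdges.

Variable V : finType.
Implicit Types (E : rel V) (A B : {set V}) (d k : nat).

Definition min_degree_in E A B d : Prop :=
  {in A, forall a, d <= degree_in E B a}.

Lemma leq_mul_sub d k n : d <= k -> 2 * k <= n -> d * (n - d) <= k * (n - k).
Proof. nia. Qed.

(* Each of the n - deg y >= deg x non-neighbours of y has degree at most
   deg x <= n/2. *)
Lemma low_degree_sum_non_edges E A B d x y :
    symmetric E -> #|A| = #|B| -> d <= degree_in E B x <= degree_in E A y ->
    degree_in E B x + degree_in E A y <= #|A| ->
    {in A, forall a, ~~ E a y -> degree_in E B a <= degree_in E B x} ->
  d * (#|A| - d) <= non_edges E A B.
Proof.
move=> symE eqAB /andP[dx le_xy] deg_sum maxx.
pose S := neighbors (compl_rel E) A y.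
have card_S : #|S| = #|A| - degree_in E A y.
  by rewrite -(degree_in_compl E A y) addKn.
have subSA : S \subset A := neighbors_subset _ A y.
have degS : {in S, forall a, degree_in E B a <= degree_in E B x}.
  by move=> a /[!inE] /andP[aA]; rewrite /compl_rel symE; apply: maxx.
apply: leq_trans (low_degree_non_edges subSA degS); rewrite card_S -eqAB.
apply: leq_trans (leq_mul_sub dx _) _; first lia.
by rewrite leq_mul2r; apply/orP; right; lia.
Qed.

Lemma exists_large_degree_sum E A B d :
    symmetric E -> #|A| = #|B| ->
    min_degree_in E A B d -> min_degree_in E B A d ->
    0 < non_edges E A B < d * (#|A| - d) ->
  exists x y, [/\ x \in A, y \in B, ~~ E x y &
    #|A| < degree_in E B x + degree_in E A y].
Proof.
move=> symE eqAB degA degB /andP[/edges_between_gt0P[x0 [y0 []]]].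
move=> x0A y0B nE0 few; pose nonadjacent :=
  [pred p : V * V | [&& p.1 \in A, p.2 \in B & ~~ E p.1 p.2]].
pose degree_sum (p : V * V) := degree_in E B p.1 + degree_in E A p.2.
have nonadj0 : nonadjacent (x0, y0) by rewrite /= x0A y0B.
case: (arg_maxnP degree_sum nonadj0) => -[x y] /and3P[/= xA yB nExy] maxxy.
exists x, y; split=> //; rewrite ltnNge; apply: contraTN few => small.
rewrite -leqNgt.
have [le_xy | lt_yx] := leqP (degree_in E B x) (degree_in E A y).
  apply: (low_degree_sum_non_edges (x := x) (y := y)) => //.
    by rewrite degA.
  move=> a aA nEay; have := maxxy (a, y).
  by rewrite /= aA yB nEay leq_add2r; apply.
rewrite /non_edges eqAB edges_betweenC; last exact: compl_rel_sym.
apply: (low_degree_sum_non_edges (x := y) (y := x)) => //.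
- by rewrite degB //= ltnW.
- by rewrite addnC -eqAB.
move=> b bB nEbx; have := maxxy (x, b).
by rewrite /= xA bB symE nEbx leq_add2l; apply.
Qed.

Theorem moon_moser E A B d :
    symmetric E -> bipartite_on E A B -> #|A| = #|B| ->
    min_degree_in E A B d -> min_degree_in E B A d ->
    non_edges E A B < d * (#|A| - d) ->
  hamiltonian_on E (A :|: B).
Proof.
have [m] := ubnP (non_edges E A B); elim: m E => // m IHm E.
rewrite ltnS => le_m symE bipE eqAB degA degB few.
have [/eqP/non_edges_eq0P complete | nE_gt0] := posnP (non_edges E A B).
  by apply: complete_bipartite_hamiltonian => //; case: bipE.
have [|x [y [xA yB nExy deg_sum]]] :=
    exists_large_degree_sum symE eqAB degA degB.
  by rewrite nE_gt0.
apply: (hamiltonian_on_add_edge symE bipE _ xA deg_sum).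
  by rewrite (bipartite_on_card bipE); nia.
have fewer : non_edges (add_edge E x y) A B < non_edges E A B.
  apply: (ltn_edges_between (x := x) (y := y)) => // [u v|].
  - by apply/contra/add_edge_sub.
  - by rewrite /compl_rel /add_edge !eqxx orbT.
have subE := @add_edge_sub _ E x y.
apply: IHm.
- exact: leq_trans fewer le_m.
- exact: add_edge_sym.
- exact: add_edge_bipartite_on.
- by [].
- by move=> a /degA/leq_trans; apply; apply: sub_degree_in.
- by move=> b /degB/leq_trans; apply; apply: sub_degree_in.
- exact: ltn_trans fewer few.
Qed.

Lemma min_degree_inD1 E A B x y :
    #|A| = #|B| -> x \in A -> y \in B ->
    {in A, forall a,
      degree_in (compl_rel E) B a <= degree_in (compl_rel E) B x} ->
    non_edges E A B < 2 * (#|A| - 2) ->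
  min_degree_in E (A :\ x) (B :\ y) 2.
Proof.
move=> eqAB xA yB maxx few a aAx; have /[!inE] /andP[_ aA] := aAx.
have : degree_in (compl_rel E) B x + degree_in (compl_rel E) B a
    <= non_edges E A B.
  rewrite /non_edges /edges_between (big_setD1 x xA) leq_add2l.
  by rewrite (big_setD1 a aAx) leq_addr.
have := maxx a aA; have := degree_in_compl E B a.
have := leq_b1 (E a y); rewrite (degree_inD1 _ a yB); lia.
Qed.

Theorem few_non_edges_cycles E A B k :
    symmetric E -> bipartite_on E A B -> #|A| = #|B| ->
    min_degree_in E A B 2 -> min_degree_in E B A 2 ->
    non_edges E A B < 2 * (#|A| - 2) -> 1 < k <= #|A| ->
  has_cycle_of_length E (2 * k).
Proof.
move=> symE; have [m] := ubnP #|A|.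
elim: m A B => // m IHm A B lt_m bipE eqAB degA degB few /andP[gt1].
rewrite leq_eqVlt => /predU1P[def_k | lt_k].
  have cardAB : #|A :|: B| = 2 * k.
    by rewrite (bipartite_on_card bipE) -eqAB def_k mul2n addnn.
  rewrite -cardAB; apply: hamiltonian_on_cycle; first by rewrite cardAB; lia.
  exact: moon_moser degA degB few.
have symC := compl_rel_sym symE.
have A_neq0 : A != set0 by rewrite -card_gt0; lia.
have B_neq0 : B != set0 by rewrite -card_gt0; lia.
have [x [y [xA yB maxx maxy fewer]]] :=
  delete_max_degree_pair symC A_neq0 B_neq0.
have cardA : #|A| = #|A :\ x|.+1 by rewrite (cardsD1 x) xA.
have cardB : #|B| = #|B :\ y|.+1 by rewrite (cardsD1 y) yB.
have bipE' := bipartite_on_subset (subD1set A x) (subD1set B y) bipE.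
case: fewer => [/eqP/non_edges_eq0P complete | fewer].
  by apply: (complete_bipartite_cycles symE bipE' _ _ complete); lia.
apply: (IHm (A :\ x) (B :\ y)) => //.
- by lia.
- by lia.
- exact: min_degree_inD1.
- by apply: min_degree_inD1; rewrite -?eqAB // /non_edges edges_betweenC.
- by rewrite /non_edges in few *; lia.
- by lia.
Qed.

End FewNonEdges.

Section Bipartition.

Variables (V : finType) (E : rel V).
Implicit Types X Y : {set V}.

Lemma bipartitionC X Y : bipartition E X Y -> bipartition E Y X.
Proof.
case=> XYT dXY bip; split; rewrite 1?setUC 1?disjoint_sym //.
by move=> u v /bip[] []; [right | left].
Qed.

Lemma bipartition_neighbor X Y x y :
  bipartition E X Y -> x \in X -> E x y -> y \in Y.
Proof. by case=> _ dXY bip xX /bip[[] | []] //; rewrite (disjointFr dXY). Qed.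

Lemma bipartition_bipartite_on X Y :
  bipartition E X Y -> bipartite_on E X Y.
Proof.
move=> bip; have [_ dXY _] := bip.
split=> // u v uS vS; apply/negP.
  by move/(bipartition_neighbor bip uS); rewrite (disjointFr dXY).
by move/(bipartition_neighbor (bipartitionC bip) uS); rewrite (disjointFl dXY).
Qed.

Lemma degree_in_bipartition X Y x :
  bipartition E X Y -> x \in X -> degree_in E Y x = degree E x.
Proof.
move=> bip xX; apply: eq_card => y; rewrite !inE andb_idl //.
exact: bipartition_neighbor bip xX.
Qed.

Lemma bipartition_card X Y : bipartition E X Y -> #|V| = #|X| + #|Y|.
Proof.
move=> bip; rewrite -(bipartite_on_card (bipartition_bipartite_on bip)).
by case: bip => -> _ _; rewrite cardsT.
Qed.

Lemma min_degree_le v : min_degree E <= degree E v.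
Proof. exact: (bigmin_le #|V| v (degree E)). Qed.

End Bipartition.

Section AdjacencySpectrum.

Local Open Scope ring_scope.

Definition sqr_norm (R : pzSemiRingType) (V : finType) (f : V -> R)
    (A : {set V}) : R :=
  \sum_(v in A) f v ^+ 2.

Definition eigenfunction (R : pzRingType) (V : finType) (E : rel V) (l : R)
    (f : V -> R) : Prop :=
  forall v, \sum_(w | E v w) f w = l * f v.

Lemma adjacency_eigenfunction (R : realType) (V : finType) (E : rel V) (l : R) :
    symmetric E -> eigenvalue (adjacency_matrix E R) l ->
  exists2 f, eigenfunction E l f & exists v, f v != 0.
Proof.
move=> symE /eigenvalueP[u eig_u /rV0Pn[i ui]].
exists (fun v => u 0 (enum_rank v)); last first.
  by exists (enum_val i); rewrite enum_valK.
move=> v; move/rowP/(_ (enum_rank v)): eig_u; rewrite !mxE => <-.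
rewrite (reindex_onto enum_val enum_rank) /= => [|w _]; last first.
  by rewrite enum_rankK.
rewrite big_mkcond; apply: eq_bigr => j _.
rewrite !mxE enum_rankK enum_valK eqxx andbT symE.
by case: (E _ _); rewrite (mulr1, mulr0).
Qed.

Lemma eigenfunction_form (R : comNzRingType) (V : finType) (E : rel V)
    (X Y : {set V}) (l : R) (f : V -> R) :
    bipartition E X Y -> eigenfunction E l f ->
  \sum_(x in X) \sum_(y in Y) (E x y)%:R * (f x * f y) =
  l * sqr_norm f X.
Proof.
move=> bip eig_f; rewrite /sqr_norm mulr_sumr; apply: eq_bigr => x xX.
rewrite expr2 mulrCA -eig_f mulr_sumr big_mkcond [RHS]big_mkcond.
apply: eq_bigr => y _; case Exy: (E x y); last by rewrite mul0r if_same.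
by rewrite mul1r (bipartition_neighbor bip xX Exy).
Qed.

Variables (R : realFieldType) (V : finType) (E : rel V) (X Y : {set V}).
Hypotheses (symE : symmetric E) (bip : bipartition E X Y).
Variables (l : R) (f : V -> R).
Hypotheses (eig_f : eigenfunction E l f) (l_neq0 : l != 0).

Lemma eigenfunction_balanced : sqr_norm f Y = sqr_norm f X.
Proof.
apply: (mulfI l_neq0); rewrite -(eigenfunction_form (bipartitionC bip) eig_f).
rewrite -(eigenfunction_form bip eig_f) exchange_big.
by apply: eq_bigr => x _; apply: eq_bigr => y _; rewrite symE [f y * _]mulrC.
Qed.

Lemma eigenfunction_sqr_norm_gt0 v : f v != 0 -> 0 < sqr_norm f X.
Proof.
move=> fv; have [XYT _ _] := bip.
have sqr_norm_gt0 (A : {set V}) : v \in A -> 0 < sqr_norm f A.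
  move=> vA; rewrite /sqr_norm (bigD1 v) //= ltr_wpDr ?exprn_even_gt0 //.
  by apply: sumr_ge0 => u _; apply: sqr_ge0.
have : v \in X :|: Y by rewrite XYT.
by rewrite inE => /orP[] /sqr_norm_gt0; rewrite ?eigenfunction_balanced.
Qed.

Definition rank_one_error x y : R :=
  sqr_norm f X * (E x y)%:R - l * (f x * f y).

Lemma rank_one_errorE :
  \sum_(x in X) \sum_(y in Y) rank_one_error x y ^+ 2 =
  sqr_norm f X ^+ 2 * ((edges_between E X Y)%:R - l ^+ 2).
Proof.
set S := sqr_norm f X.
have sum_edges :
    \sum_(x in X) \sum_(y in Y) (E x y)%:R = (edges_between E X Y)%:R :> R.
  rewrite /edges_between natr_sum; apply: eq_bigr => x _.
  by rewrite degree_in_sum natr_sum.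
have sum_sqr : \sum_(x in X) \sum_(y in Y) (f x * f y) ^+ 2 = S ^+ 2.
  rewrite expr2 /S -{2}eigenfunction_balanced mulr_suml; apply: eq_bigr => x _.
  by rewrite mulr_sumr; apply: eq_bigr => y _; rewrite exprMn.
transitivity (\sum_(x in X) \sum_(y in Y) (S ^+ 2 * (E x y)%:R
   - 2 * S * l * ((E x y)%:R * (f x * f y)) + l ^+ 2 * (f x * f y) ^+ 2)).
  apply: eq_bigr => x _; apply: eq_bigr => y _.
  by rewrite /rank_one_error -/S; case: (E x y) => /=; ring.
under eq_bigr do rewrite big_split sumrB -!mulr_sumr /=.
rewrite big_split sumrB -!mulr_sumr /= sum_edges sum_sqr.
by rewrite (eigenfunction_form bip eig_f) -/S; ring.
Qed.

Lemma sqr_eigenvalue_ge_edges_complete :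
    (exists v, f v != 0) -> (forall v, 0 < degree E v)%N ->
    (edges_between E X Y)%:R <= l ^+ 2 ->
  {in X & Y, forall x y, E x y}.
Proof.
move=> [v fv] deg_gt0 le_l; have S_gt0 := eigenfunction_sqr_norm_gt0 fv.
have error_ge0 x : 0 <= \sum_(y in Y) rank_one_error x y ^+ 2.
  by apply: sumr_ge0 => y _; apply: sqr_ge0.
have error0 : \sum_(x in X) \sum_(y in Y) rank_one_error x y ^+ 2 = 0.
  apply/le_anti; rewrite sumr_ge0 // andbT rank_one_errorE.
  by rewrite pmulr_rle0 ?exprn_gt0 // subr_le0.
have rank1 : {in X & Y, forall x y,
    sqr_norm f X * (E x y)%:R = l * (f x * f y)}.
  move=> x y xX yY.
  move/psumr_eq0P: error0 => /(_ (fun x _ => error_ge0 x) x xX).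
  move/psumr_eq0P => /(_ (fun y _ => sqr_ge0 _) y yY) /eqP.
  by rewrite sqrf_eq0 subr_eq0 => /eqP.
have f_neq0_of u w :
    E u w -> sqr_norm f X * (E u w)%:R = l * (f u * f w) -> f u != 0.
  move=> ->; rewrite mulr1; apply: contra_eqN => /eqP->.
  by rewrite mul0r mulr0 gt_eqF.
have adjacent u : exists w, E u w.
  by have /card_gt0P[w] := deg_gt0 u; rewrite inE; exists w.
move=> x y xX yY; apply: contraT => /negPf nExy; move/eqP: (rank1 x y xX yY).
rewrite nExy mulr0 eq_sym !mulf_eq0 (negPf l_neq0) /=.
have [y' Exy'] := adjacent x; have [x' Eyx'] := adjacent y.
have y'Y := bipartition_neighbor bip xX Exy'.
have x'X := bipartition_neighbor (bipartitionC bip) yY Eyx'.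
rewrite (negPf (f_neq0_of x y' Exy' (rank1 x y' xX y'Y))) /=.
rewrite (negPf (f_neq0_of y x' Eyx' _)) //.
by rewrite symE [f y * _]mulrC rank1.
Qed.

End AdjacencySpectrum.

Lemma large_eigenvalue_few_non_edges (R : realType) (V : finType) (E : rel V)
    (X Y : {set V}) (n : nat) (l : R) :
    symmetric E -> bipartition E X Y -> (forall v, 0 < degree E v) ->
    #|X| = n -> #|Y| = n -> 2 < n -> eigenvalue (adjacency_matrix E R) l ->
    (Num.sqrt (n%:R ^+ 2 - 2 * n%:R + 4) <= l)%R ->
  non_edges E X Y < 2 * (n - 2).
Proof.
move=> symE bip deg_gt0 cardX cardY n_gt2 eig_l ge_sqrt.
have rad_gt0 : (0 < n%:R ^+ 2 - 2 * n%:R + 4 :> R)%R by nra.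
have l_gt0 : (0 < l)%R by apply: lt_le_trans ge_sqrt; rewrite sqrtr_gt0.
have le_l2 : (n%:R ^+ 2 - 2 * n%:R + 4 <= l ^+ 2)%R.
  by rewrite -(sqr_sqrtr (ltW rad_gt0)) lerXn2r ?nnegrE ?sqrtr_ge0 // ltW.
have [f eig_f f_neq0] := adjacency_eigenfunction symE eig_l.
have [lt_edges | le_edges] :=
    ltP (l ^+ 2)%R (edges_between E X Y)%:R%R; last first.
  have /non_edges_eq0P/eqP-> := sqr_eigenvalue_ge_edges_complete symE bip eig_f
    (lt0r_neq0 l_gt0) f_neq0 deg_gt0 le_edges.
  by rewrite muln_gt0 subn_gt0.
have edges_gt : n * n + 4 < edges_between E X Y + 2 * n.
  rewrite -(ltr_nat R) !natrD !natrM; have := le_lt_trans le_l2 lt_edges; lra.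
have := edges_between_compl E X Y; rewrite cardX cardY; lia.
Qed.

Theorem theorem1 (R : realType) (V : finType) (E : rel V) (X Y : {set V})
    (n e : nat) (lambda1 : R)
    (hG : simple_graph E)
    (hbip : bipartition E X Y)
    (hbal : #|X| = #|Y|)
    (hconn : connected_graph E)
    (hord : #|V| = (2 * n)%N)
    (hn : (4 <= n)%N)
    (he : #|edges E| = e)
    (hdelta : (2 <= min_degree E)%N)
    (hlambda1 : largest_eigenvalue (adjacency_matrix E R) lambda1)
    (hspec : (Num.sqrt (n%:R ^+ 2 - 2 * n%:R + 4) <= lambda1)%R) :
  bipancyclic E.
Proof.
have [symE _] := hG; have [eig_lambda1 _] := hlambda1.
have deg_ge2 v : 2 <= degree E v := leq_trans hdelta (min_degree_le E v).
have cardX : #|X| = n by have := bipartition_card hbip; lia.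
have cardY : #|Y| = n by rewrite -hbal.
have few : non_edges E X Y < 2 * (n - 2).
  apply: large_eigenvalue_few_non_edges eig_lambda1 hspec => // [v|].
    exact: ltnW.
  exact: ltnW.
move=> k /andP[k_ge4 k_le] /even_halfK <-; rewrite -mul2n.
apply: (few_non_edges_cycles symE (bipartition_bipartite_on hbip) hbal).
- by move=> x xX; rewrite (degree_in_bipartition hbip xX).
- by move=> y yY; rewrite (degree_in_bipartition (bipartitionC hbip) yY).
- by rewrite cardX.
- by lia.
Qed.
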